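(* Let $n\ge 1$ and let $\{V_{1},V_{2},\dots,V_{n}\}$ be a collection of $n$ pairwise independent valuation domains, none of which is a field, all with the same quotient field $K$, such that $D=V_{1}\cap V_{2}\cap\cdots\cap V_{n}$ is a GMPD domain. Then: (a) $|\mathcal{O}_{ql}(D)|=n+1$ if and only if no $V_{i}$ has value group $\mathbb{Z}\times\mathbb{Z}$; (b) $|\mathcal{O}_{ql}(D)|=2n+1$ if and only if every $V_{i}$ has value group $\mathbb{Z}\times\mathbb{Z}$.
   Context: All rings are commutative unitary integral domains. Two incomparable (under inclusion) valuation domains with the same quotient field are independent if they have no nonzero common prime ideal. Value groups are considered up to isomorphism of ordered groups, and $\mathbb{Z}\times\mathbb{Z}$ carries the lexicographic order. A ring is quasi-local if it has exactly one maximal ideal (no Noetherian assumption). For an integral domain $D$ with quotient field $K$, an overring of $D$ is a subring of $K$ containing $D$; $\mathcal{O}_{ql}(D)$ is the set of those overrings of $D$ which are quasi-local. $D$ is h-local if each nonzero ideal of $D$ is contained in only finitely many maximal ideals and each nonzero prime ideal is contained in a unique maximal ideal. An MNI ideal of $D$ is an ideal of $D$ which is maximal (under inclusion) among the non-invertible ideals of $D$ (the zero ideal counts as non-invertible). $D$ is an MPD domain if it has a unique MNI ideal $Q$ and every nonzero non-invertible ideal of $D$ can be written as $JQ$ for some invertible ideal $J$ of $D$. $D$ is a GMPD domain (globalized multiplicatively pinched-Dedekind domain) if $D$ is h-local and the localization $D_M$ is an MPD domain for every maximal ideal $M$ of $D$. *)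

(* Defs.v *)
From HB Require Import structures.
From mathcomp Require Import all_boot all_order all_algebra.
From mathcomp Require Import boolp classical_sets functions cardinality.

Set Implicit Arguments.
Unset Strict Implicit.
Unset Printing Implicit Defensive.

Import Order.TTheory GRing.Theory Num.Theory.

Local Open Scope classical_set_scope.
Local Open Scope ring_scope.

(* Every integral domain below is a subring [D : set K] of an ambient field
   [K]; its overrings, ideals and fractional ideals are subsets of [K]. *)

Definition is_subring (K : fieldType) (D : set K) : Prop :=
  subring_closed (mem D).

(* Computed inside K; it need not be all of K. *)
Definition quotient_field (K : fieldType) (D : set K) : set K :=
  [set x | exists a b : K, [/\ D a, D b, b <> 0 & x = a / b]].

Definition is_field (K : fieldType) (D : set K) : Prop :=
  forall x : K, D x -> x <> 0 -> D x^-1.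

Definition submodule (K : fieldType) (D I : set K) : Prop :=
  [/\ I 0,
      forall x y : K, I x -> I y -> I (x + y)
    & forall a x : K, D a -> I x -> I (a * x)].

Definition ideal (K : fieldType) (D I : set K) : Prop :=
  submodule D I /\ I `<=` D.

Definition prime_ideal (K : fieldType) (D P : set K) : Prop :=
  [/\ ideal D P, P <> D
    & forall a b : K, D a -> D b -> P (a * b) -> P a \/ P b].

Definition maximal_ideal (K : fieldType) (D M : set K) : Prop :=
  [/\ ideal D M, M <> D
    & forall I : set K, ideal D I -> I <> D -> M `<=` I -> I = M].

Definition fractional_ideal (K : fieldType) (D J : set K) : Prop :=
  [/\ submodule D J, J `<=` quotient_field D
    & exists d : K, [/\ D d, d <> 0 & forall x : K, J x -> D (d * x)]].

Definition ideal_mul (K : fieldType) (I J : set K) : set K :=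
  [set x | exists (m : nat) (a b : 'I_m -> K),
     [/\ forall i, I (a i), forall i, J (b i) & x = \sum_(i < m) a i * b i]].

Definition invertible_ideal (K : fieldType) (D I : set K) : Prop :=
  ideal D I /\ exists J : set K, fractional_ideal D J /\ ideal_mul I J = D.

Definition localization (K : fieldType) (D M : set K) : set K :=
  [set x | exists a s : K, [/\ D a, D s, ~ M s & x = a / s]].

Definition quasi_local (K : fieldType) (D : set K) : Prop :=
  exists! M : set K, maximal_ideal D M.

Definition overring (K : fieldType) (D R : set K) : Prop :=
  [/\ is_subring R, D `<=` R & R `<=` quotient_field D].

Definition O_ql (K : fieldType) (D : set K) : set (set K) :=
  [set R | overring D R /\ quasi_local R].

Definition h_local (K : fieldType) (D : set K) : Prop :=
  (forall I : set K, ideal D I -> I <> [set 0] ->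
     finite_set [set M : set K | maximal_ideal D M /\ I `<=` M]) /\
  (forall P : set K, prime_ideal D P -> P <> [set 0] ->
     exists! M : set K, maximal_ideal D M /\ P `<=` M).

Definition MNI_ideal (K : fieldType) (D Q : set K) : Prop :=
  [/\ ideal D Q, ~ invertible_ideal D Q
    & forall I : set K,
        ideal D I -> ~ invertible_ideal D I -> Q `<=` I -> I = Q].

Definition MPD (K : fieldType) (D : set K) : Prop :=
  exists Q : set K,
    unique (MNI_ideal D) Q /\
    (forall I : set K,
       ideal D I -> I <> [set 0] -> ~ invertible_ideal D I ->
       exists J : set K, invertible_ideal D J /\ I = ideal_mul J Q).

Definition GMPD (K : fieldType) (D : set K) : Prop :=
  h_local D /\
  (forall M : set K, maximal_ideal D M -> MPD (localization D M)).

Definition valuation_domain (K : fieldType) (V : set K) : Prop :=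
  is_subring V /\
  (forall x : K, quotient_field V x -> x <> 0 -> V x \/ V x^-1).

Definition independent (K : fieldType) (V W : set K) : Prop :=
  [/\ ~ (V `<=` W), ~ (W `<=` V)
    & ~ exists P : set K,
          [/\ prime_ideal V P, prime_ideal W P & P <> [set 0]]].

Definition units (K : fieldType) (V : set K) : set K :=
  [set u | [/\ V u, u <> 0 & V u^-1]].

(* The quotient of the multiplicative group of the quotient field by the
   units of V; its elements are the cosets, as subsets of K. *)
Definition value_group (K : fieldType) (V : set K) : set (set K) :=
  [set [set x * u | u in units V] | x in quotient_field V `\ 0].

Definition value_group_op (K : fieldType) (A B : set K) : set K :=
  [set a * b | a in A & b in B].

Definition value_group_le (K : fieldType) (V A B : set K) : Prop :=
  exists a b : K, [/\ A a, B b & V (b / a)].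

(* The value group, written multiplicatively, is isomorphic as an ordered
   group to Z x Z with the lexicographic order; [int *l int] is [int * int]
   with that order. *)
Definition value_group_ZxZ (K : fieldType) (V : set K) : Prop :=
  exists phi : set K -> int * int,
    [/\ set_bij (value_group V) [set: int * int] phi,
        forall A B : set K, value_group V A -> value_group V B ->
          phi (value_group_op A B) = phi A + phi B
      & forall A B : set K, value_group V A -> value_group V B ->
          (value_group_le V A B <->
           ((phi A : (int *l int)%type) <= (phi B : (int *l int)%type))%O)].

(* Main.v *)
Require Import Defs.
From HB Require Import structures.
From mathcomp Require Import all_boot all_order all_algebra.
From mathcomp Require Import boolp classical_sets functions cardinality.
From mathcomp Require Import ring.

Set Implicit Arguments.
Unset Strict Implicit.
Unset Printing Implicit Defensive.

Import Order.TTheory GRing.Theory Num.Theory.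

Local Open Scope classical_set_scope.
Local Open Scope ring_scope.

(** The quasi-local overrings of D are exactly the rings lying between some V i
    and K. For x in K, the element y = 1 / (1 + x + ... + x ^ s) lies in D
    together with y * x, for a suitable s, and is a unit in each V i containing
    x ([common_denominator]); hence V i is the localization of D at the
    contraction of its maximal ideal ([localization_center]). Prime avoidance
    shows that each proper ideal of D is contained in one of these n
    contractions ([proper_ideal_center]), which are therefore maximal ideals of
    D. So each V i is an MPD domain, and a quasi-local overring of D contains
    some V i ([quasi_local_overring]); conversely an overring of V i is a
    valuation ring, hence quasi-local. By independence the only common overring
    of two distinct V i is K.

    It remains to find the rings strictly between an MPD valuation ring V and K.
    Nonzero noninvertible ideals of V are scalar multiples of one ideal, since
    invertible ideals of V are principal. If W is an intermediate ring, then its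
    maximal ideal, and c W for each nonzero c in it, are such ideals, as is the maximal
    ideal of V unless it is principal. Comparing them shows that W is the only
    intermediate ring and that the maximal ideals of W and V are principal, say
    e W and p V. Then each nonzero x is e ^ k * p ^ l times a unit of V, for
    unique k and l, which gives the value group Z x Z ([intermediate_ZxZ]).
    Conversely, if the value group is Z x Z, inverting an element of value
    (0, 1) produces an intermediate ring ([ZxZ_intermediate]).

    Thus D has 1 + n + t quasi-local overrings, where t is the number of indices
    i such that V i has value group Z x Z. The two equivalences are the cases
    t = 0 and t = n. *)

(** * Subrings of a field *)

Lemma is_subringE (K : fieldType) (D : set K) :
  is_subring D <->
  [/\ D 1, forall x y, D x -> D y -> D (x - y)
    & forall x y, D x -> D y -> D (x * y)].
Proof.
split=> -[D1 DB DM]; split.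
- by rewrite inE in D1.
- by move=> x y Dx Dy; have := DB x y; rewrite !inE; exact.
- by move=> x y Dx Dy; have := DM x y; rewrite !inE; exact.
- by rewrite inE.
- by move=> x y; rewrite !inE; exact: DB.
- by move=> x y; rewrite !inE; exact: DM.
Qed.

Lemma subring1 (K : fieldType) (D : set K) : is_subring D -> D 1.
Proof. by case/is_subringE. Qed.

Lemma subringB (K : fieldType) (D : set K) x y :
  is_subring D -> D x -> D y -> D (x - y).
Proof. by case/is_subringE => _ + _; exact. Qed.

Lemma subringM (K : fieldType) (D : set K) x y :
  is_subring D -> D x -> D y -> D (x * y).
Proof. by case/is_subringE => _ _; exact. Qed.

Lemma subring0 (K : fieldType) (D : set K) : is_subring D -> D 0.
Proof.
by move=> rD; rewrite -(subrr 1); apply: subringB => //; exact: subring1.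
Qed.

Lemma subringN (K : fieldType) (D : set K) x : is_subring D -> D x -> D (- x).
Proof.
by move=> rD Dx; rewrite -sub0r; apply: subringB => //; exact: subring0.
Qed.

Lemma subringD (K : fieldType) (D : set K) x y :
  is_subring D -> D x -> D y -> D (x + y).
Proof.
by move=> rD Dx Dy; rewrite -[y]opprK; apply: subringB => //; exact: subringN.
Qed.

Lemma subringX (K : fieldType) (D : set K) x n :
  is_subring D -> D x -> D (x ^+ n).
Proof.
move=> rD Dx; elim: n => [|n IHn]; first exact: subring1.
by rewrite exprS; exact: subringM.
Qed.

Lemma subring_setT (K : fieldType) : is_subring [set: K].
Proof. by apply/is_subringE. Qed.

Lemma units1 (K : fieldType) (V : set K) : is_subring V -> units V 1.
Proof.
move=> rV; split; [exact: subring1 | by apply/eqP; exact: oner_neq0 |].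
by rewrite invr1; exact: subring1.
Qed.

Lemma unitsM (K : fieldType) (V : set K) x y :
  is_subring V -> units V x -> units V y -> units V (x * y).
Proof.
move=> rV [Vx /eqP x0 Vx'] [Vy /eqP y0 Vy']; split; first exact: subringM.
  by apply/eqP; rewrite mulf_neq0.
by rewrite invfM; exact: subringM.
Qed.

Lemma unitsV (K : fieldType) (V : set K) x : units V x -> units V x^-1.
Proof.
by move=> [Vx /eqP x0 Vx']; split; rewrite ?invrK //; apply/eqP; rewrite invr_eq0.
Qed.

Lemma unitsX (K : fieldType) (V : set K) x n :
  is_subring V -> units V x -> units V (x ^+ n).
Proof.
move=> rV Vx; elim: n => [|n IHn]; first exact: units1.
by rewrite exprS; exact: unitsM.
Qed.

Lemma sub_units (K : fieldType) (V W : set K) :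
  V `<=` W -> units V `<=` units W.
Proof. by move=> VW x [Vx x0 Vx']; split=> //; exact: VW. Qed.

Lemma units_factor (K : fieldType) (V : set K) x y :
  is_subring V -> V x -> V y -> units V (x * y) -> units V x.
Proof.
move=> rV Vx Vy [_ /eqP xy0 Vxy]; move: (xy0); rewrite mulf_eq0 negb_or.
case/andP=> x0 y0; split=> //; first by apply/eqP.
rewrite (_ : x^-1 = y * (x * y)^-1); first exact: subringM.
by rewrite invfM mulrCA mulfV // mulr1.
Qed.

Definition nonunits (K : fieldType) (V : set K) : set K :=
  V `\` units V.


Lemma proper_ideal1 (K : fieldType) (R I : set K) :
  ideal R I -> I <> R -> ~ I 1.
Proof.
case=> -[_ _ IM] IR neq I1; apply: neq; apply/seteqP; split=> // y Ry.
by rewrite -(mulr1 y); exact: IM.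
Qed.

Lemma proper_ideal_nonunits (K : fieldType) (R I : set K) :
  ideal R I -> I <> R -> I `<=` nonunits R.
Proof.
move=> idI neq x Ix; split; first by case: idI => _; exact.
case=> Rx /eqP x0 Rx'; apply: (proper_ideal1 idI neq).
by rewrite -(mulVf x0); case: idI => -[_ _ IM] _; exact: IM.
Qed.

Lemma subringT_ideal (K : fieldType) (R : set K) : is_subring R -> ideal R R.
Proof.
move=> rR; split=> //; split; first exact: subring0.
  by move=> x y; exact: subringD.
by move=> a x; exact: subringM.
Qed.

Lemma principal_ideal (K : fieldType) (R : set K) a :
  is_subring R -> R a -> ideal R [set a * x | x in R].
Proof.
move=> rR Ra; split; last by move=> _ [x Rx <-]; exact: subringM.
split; first by exists 0; [exact: subring0 | rewrite mulr0].
  move=> _ _ [x Rx <-] [y Ry <-]; exists (x + y); last by rewrite mulrDr.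
  exact: subringD.
by move=> c _ Rc [x Rx <-]; exists (c * x); [exact: subringM | rewrite mulrCA].
Qed.

Lemma ideal_sum (K : fieldType) (R I : set K) m (F : 'I_m -> K) :
  ideal R I -> (forall i, I (F i)) -> I (\sum_(i < m) F i).
Proof. by case=> -[I0 ID _] _ IF; apply: big_ind. Qed.

Lemma ex_maximal_ideal (K : fieldType) (R I : set K) :
  is_subring R -> ideal R I -> I <> R -> exists M, maximal_ideal R M /\ I `<=` M.
Proof.
move=> rR idI neq.
(* The members of the chain are joined with I, so that the empty chain has
   the upper bound I. *)
pose P (A : set K) := ideal R (A `|` I) /\ A `|` I <> R.
have [F FP Ftot|A [[idA An] Amax]] := @Zorn_bigcup K P.
- pose U := \bigcup_(X in F) X.
  have sub X : F X -> X `<=` U by move=> FX x Xx; exists X.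
  have R1 : ~ (U `|` I) 1.
    case=> [[X FX X1]|]; last exact: proper_ideal1 idI neq.
    by have [idX nX] := FP _ FX; apply: (proper_ideal1 idX nX); left.
  have idU : ideal R (U `|` I).
    have [[I0 ID IM] IR] := idI.
    (* The family is a chain, so two elements of the union share a member. *)
    have two x y : (U `|` I) x -> (U `|` I) y -> exists J,
      [/\ ideal R J, J `<=` U `|` I, J x & J y].
      have one X : F X -> ideal R (X `|` I) /\ X `|` I `<=` U `|` I.
        by move=> FX; split; [case: (FP _ FX) | apply: setSU; exact: sub].
      case=> [[X FX Xx]|Ix] [[Y FY Yy]|Iy].
      - have [XY|YX] := Ftot _ _ FX FY.
          have [? ?] := one _ FY; exists (Y `|` I); split=> //; left=> //.
          exact: XY.
        have [? ?] := one _ FX; exists (X `|` I); split=> //; left=> //.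
        exact: YX.
      - by have [? ?] := one _ FX; exists (X `|` I); split=> //; [left|right].
      - by have [? ?] := one _ FY; exists (Y `|` I); split=> //; [right|left].
      - by exists I; split=> //; right.
    split; first split; first by right.
    + move=> x y Ux Uy; have [J [[[_ JD _] _] JU Jx Jy]] := two x y Ux Uy.
      exact/JU/JD.
    + move=> a x Ra Ux; have [J [[[_ _ JM] _] JU Jx _]] := two x x Ux Ux.
      exact/JU/JM.
    + move=> x Ux; have [J [[_ JR] _ Jx _]] := two x x Ux Ux.
      exact: JR.
  by split=> // UR; apply: R1; rewrite UR; exact: subring1.
- exists (A `|` I); split; last by move=> x Ix; right.
  split=> // J idJ nJ AJ; apply/seteqP; split=> //.
  have IJ : J `|` I = J by apply/setUidPl => x Ix; apply: AJ; right.
  move=> x Jx; have [Ax|nAx] := pselect (A x); first by left.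
  exfalso; apply: (Amax J); last by rewrite /P IJ.
  by split=> [y Ay|JA]; [apply: AJ; left | exact: nAx (JA _ Jx)].
Qed.

(** * Valuation rings and their overrings *)

Definition valuation_ring (K : fieldType) (V : set K) : Prop :=
  is_subring V /\ forall x, V x \/ V x^-1.

Lemma valuation_ring_domain (K : fieldType) (V : set K) :
  valuation_domain V -> quotient_field V = [set: K] -> valuation_ring V.
Proof.
move=> [rV Vval] VK; split=> // x; have [->|x0] := eqVneq x 0.
  by left; exact: subring0.
by apply: Vval; [rewrite VK | apply/eqP].
Qed.

Lemma valuation_quotient_field (K : fieldType) (V : set K) :
  valuation_ring V -> quotient_field V = [set: K].
Proof.
move=> [rV Vval]; apply/seteqP; split=> // x _.
have V1 := subring1 rV; have /eqP K1 := oner_neq0 K.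
have [Vx|Vx] := Vval x; first by exists x, 1; rewrite divr1.
have [x0|/eqP x0] := eqVneq x^-1 0.
  exists 0, 1; split=> //; first exact: subring0.
  by rewrite -(invrK x) x0 invr0 mul0r.
by exists 1, x^-1; rewrite invrK mul1r.
Qed.

Lemma overring_valuation (K : fieldType) (V W : set K) :
  valuation_ring V -> is_subring W -> V `<=` W -> valuation_ring W.
Proof.
by move=> [_ Vv] rW VW; split=> // x; have [/VW|/VW] := Vv x; [left|right].
Qed.

Lemma nonunitsN (K : fieldType) (V : set K) x :
  valuation_ring V -> ~ V x -> nonunits V x^-1.
Proof.
by move=> [rV Vv] nVx; have [//|Vx] := Vv x; split=> // -[_ _]; rewrite invrK.
Qed.

Lemma nonunits1 (K : fieldType) (V : set K) : is_subring V -> ~ nonunits V 1.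
Proof. by move=> rV [_]; apply; exact: units1. Qed.

(** A sum x + y is a multiple of x or of y, according to which of x / y and
    y / x lies in V. *)
Lemma nonunits_ideal (K : fieldType) (V : set K) :
  valuation_ring V -> ideal V (nonunits V).
Proof.
move=> [rV Vv]; split; last by move=> x [].
have nM a x : V a -> nonunits V x -> nonunits V (a * x).
  move=> Va [Vx nx]; split; first exact: subringM.
  by rewrite mulrC => uxa; apply: nx; exact: units_factor uxa.
split=> //; first by split; [exact: subring0 | move=> []].
move=> x y nx ny.
have [->|/eqP x0] := eqVneq x 0; first by rewrite add0r.
have [->|/eqP y0] := eqVneq y 0; first by rewrite addr0.
have [Vxy|Vxy] := Vv (x / y).
  rewrite (_ : x + y = (x / y + 1) * y); last first.
    by rewrite mulrDl divfK ?mul1r //; apply/eqP.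
  by apply: nM => //; apply: subringD => //; exact: subring1.
rewrite (_ : x + y = (1 + (x / y)^-1) * x); last first.
  by rewrite mulrDl invf_div divfK ?mul1r //; apply/eqP.
by apply: nM => //; apply: subringD => //; exact: subring1.
Qed.

Lemma nonunits_proper (K : fieldType) (V : set K) :
  is_subring V -> nonunits V <> V.
Proof. by move=> rV eqV; apply: (nonunits1 rV); rewrite eqV; exact: subring1. Qed.

Lemma valuation_quasi_local (K : fieldType) (V : set K) :
  valuation_ring V -> quasi_local V.
Proof.
move=> vV; have [rV _] := vV.
have idN := nonunits_ideal vV; have pN := nonunits_proper rV.
exists (nonunits V); split.
  split=> // I idI nI NI; apply/seteqP; split=> //.
  exact: proper_ideal_nonunits.
move=> M [idM nM Mmax]; apply: Mmax => //; exact: proper_ideal_nonunits.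
Qed.

Lemma sub_nonunits (K : fieldType) (V W : set K) :
  valuation_ring V -> V `<=` W -> nonunits W `<=` nonunits V.
Proof.
move=> [rV Vv] VW x [Wx nx]; split; last by move=> /(sub_units VW).
have [//|Vx] := Vv x; have [->|/eqP x0] := eqVneq x 0; first exact: subring0.
by case: nx; split=> //; exact: VW.
Qed.

Lemma nonunits_neq0 (K : fieldType) (W : set K) :
  valuation_ring W -> W <> [set: K] -> exists2 x, nonunits W x & x != 0.
Proof.
move=> vW nW; have [x nWx] : exists x, ~ W x.
  apply: contra_notP nW => /forallNP nx; apply/seteqP; split=> // x _.
  by apply: contrapT; exact: nx.
exists x^-1; first exact: nonunitsN.
by rewrite invr_eq0; apply: contra_notN nWx => /eqP ->; apply: subring0; case: vW.
Qed.

Lemma nonunits_neq_set0 (K : fieldType) (W : set K) :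
  valuation_ring W -> W <> [set: K] -> nonunits W <> [set 0].
Proof.
move=> vW nW N0; have [x] := nonunits_neq0 vW nW.
by rewrite N0 => /= ->; rewrite eqxx.
Qed.

Lemma nonunits_prime (K : fieldType) (V W : set K) :
  valuation_ring V -> is_subring W -> V `<=` W -> prime_ideal V (nonunits W).
Proof.
move=> vV rW VW; have vW := overring_valuation vV rW VW.
have [[N0 ND NM] _] := nonunits_ideal vW; split.
- split; last by move=> x /(sub_nonunits vV VW) [].
  by split=> // a x /VW; exact: NM.
- by move=> eqV; apply: (nonunits1 rW); rewrite eqV; apply: subring1; case: vV.
- move=> a b /VW Wa /VW Wb [_ nab]; apply: contrapT => /not_orP [na nb].
  apply: nab; apply: unitsM => //.
    by apply: contrapT => nu; case: na.
  by apply: contrapT => nu; case: nb.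
Qed.

(** A proper common overring would have its maximal ideal as a common nonzero
    prime. *)
Lemma independent_overring (K : fieldType) (V1 V2 W : set K) :
  valuation_ring V1 -> valuation_ring V2 -> independent V1 V2 ->
  is_subring W -> V1 `<=` W -> V2 `<=` W -> W = [set: K].
Proof.
move=> v1 v2 [_ _ indep] rW W1 W2; apply: contrapT => nW; apply: indep.
have vW := overring_valuation v1 rW W1.
have [x Nx x0] := nonunits_neq0 vW nW.
exists (nonunits W); split; [exact: nonunits_prime | exact: nonunits_prime |].
by move=> N0; move: Nx; rewrite N0 => /= x00; rewrite x00 eqxx in x0.
Qed.

(** * Invertible ideals of a valuation ring *)

(** In an expression of 1 as a sum of products, some product is a unit, since
    nonunits are closed under addition; its factor in I generates I. *)
Lemma invertible_principal (K : fieldType) (V I : set K) :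
  valuation_ring V -> invertible_ideal V I ->
  exists a, [/\ V a, a != 0 & I = [set a * x | x in V]].
Proof.
move=> vV [[[I0 ID IM] IV] [J [_ IJ]]]; have [rV _] := vV.
have: ideal_mul I J 1 by rewrite IJ; exact: subring1.
have IJV x y : I x -> J y -> V (x * y).
  move=> Ix Jy; rewrite -IJ; exists 1%N, (fun=> x), (fun=> y).
  by rewrite big_ord1.
case=> m [a [b [Ia Jb sum1]]].
have [i uab] : exists i, units V (a i * b i).
  apply: contrapT => /forallNP nu; apply: (nonunits1 rV); rewrite sum1.
  by apply: (ideal_sum (nonunits_ideal vV)) => i; split; [exact: IJV | exact: nu].
case: (uab) => _ /eqP ab0 Vab.
move: (ab0); rewrite mulf_eq0 negb_or => /andP[a0 b0].
exists (a i); split=> //; first exact: IV.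
apply/seteqP; split=> [x Ix|_ [x Vx <-]]; last by rewrite mulrC; exact: IM.
exists ((x * b i) * (a i * b i)^-1); first by apply: subringM => //; exact: IJV.
by field; rewrite a0 b0.
Qed.

Lemma ideal_mul_principal (K : fieldType) (V Q : set K) a :
  is_subring V -> ideal V Q ->
  ideal_mul [set a * x | x in V] Q = [set a * x | x in Q].
Proof.
move=> rV idQ; have [[Q0 QD QM] _] := idQ.
apply/seteqP; split=> [_ [m [b [c [Ib Qc ->]]]]|_ [x Qx <-]].
  pose d i := sval (cid2 (Ib i)).
  exists (\sum_(i < m) d i * c i).
    apply: (ideal_sum idQ) => i; rewrite /d; case: (cid2 _) => y /= Vy _.
    exact: QM.
  rewrite mulr_sumr; apply: eq_bigr => i _.
  by rewrite /d; case: (cid2 _) => y /= _ <-; rewrite mulrA.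
exists 1%N, (fun=> a), (fun=> x); split=> // [_|]; last by rewrite big_ord1.
by exists 1; [exact: subring1 | rewrite mulr1].
Qed.

(** * Overrings of a multiplicatively pinched-Dedekind valuation ring *)

Definition intermediate (K : fieldType) (V W : set K) : Prop :=
  [/\ is_subring W, V `<=` W, W <> V & W <> [set: K]].

Lemma intermediate_witness (K : fieldType) (V W : set K) :
  intermediate V W -> exists2 w, W w & ~ V w.
Proof.
move=> [_ VW WV _]; apply: contra_notP WV => nw; apply/seteqP; split=> // x Wx.
by apply: contrapT => nVx; apply: nw; exists x.
Qed.

(** If I = a V were a module over V[w], then a w would lie in a V. *)
Lemma module_noninvertible (K : fieldType) (V I : set K) w :
  valuation_ring V -> ~ V w -> (forall x, I x -> I (w * x)) ->
  ~ invertible_ideal V I.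
Proof.
move=> vV nw Iw /(invertible_principal vV) [a [Va a0 Ia]]; apply: nw.
have /Iw : I a by rewrite Ia; exists 1; [apply: subring1; case: vV | rewrite mulr1].
by rewrite Ia mulrC => -[v Vv /(mulfI a0) <-].
Qed.

(** Each of the two ideals is a nonzero scalar multiple of the pinching
    ideal. *)
Lemma MPD_similar (K : fieldType) (V I J : set K) :
  valuation_ring V -> MPD V ->
  ideal V I -> I <> [set 0] -> ~ invertible_ideal V I ->
  ideal V J -> J <> [set 0] -> ~ invertible_ideal V J ->
  exists2 d, d != 0 & J = [set d * x | x in I].
Proof.
move=> vV [Q [[[idQ _ _] _] allQ]]; have [rV _] := vV.
have scal A : ideal V A -> A <> [set 0] -> ~ invertible_ideal V A ->
    exists2 a, a != 0 & A = [set a * x | x in Q].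
  move=> idA A0 nA; have [B [invB ->]] := allQ _ idA A0 nA.
  have [a [_ a0 ->]] := invertible_principal vV invB.
  by exists a => //; exact: ideal_mul_principal.
move=> idI I0 nI idJ J0 nJ.
have [a a0 ->] := scal _ idI I0 nI; have [b b0 ->] := scal _ idJ J0 nJ.
exists (b / a); first by rewrite mulf_neq0 ?invr_eq0.
rewrite image_comp; congr (_ @` _); apply/funext => x /=.
by rewrite mulrA divfK.
Qed.

(** A multiple of W by a nonzero nonunit of W is an ideal of V, and is
    noninvertible because it is a W-module. *)
Lemma MPD_overring_similar (K : fieldType) (V W I : set K) :
  valuation_ring V -> MPD V -> intermediate V W ->
  ideal V I -> I <> [set 0] -> ~ invertible_ideal V I ->
  exists2 d, d != 0 & I = [set d * x | x in W].
Proof.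
move=> vV mV iW idI I0 nI; have [rW VW _ nW] := iW.
have vW := overring_valuation vV rW VW; have [w Ww nVw] := intermediate_witness iW.
have [c Nc c0] := nonunits_neq0 vW nW; have [[_ _ NM] _] := nonunits_ideal vW.
have [[B0 BD BM] _] := principal_ideal rW Nc.1.
set B := [set c * x | x in W] in B0 BD BM.
have idB : ideal V B.
  split; first by split=> // a x /VW; exact: BM.
  move=> _ [x Wx <-]; apply: (proj1 (sub_nonunits vV VW _)).
  by rewrite mulrC; exact: NM.
have Bn0 : B <> [set 0].
  move=> eqB; have: B c by exists 1; [exact: subring1 | rewrite mulr1].
  by rewrite eqB => /= /eqP; exact/negP.
have nB : ~ invertible_ideal V B.
  by apply: (module_noninvertible vV nVw) => x; exact: BM.
have [d d0 ->] := MPD_similar vV mV idB Bn0 nB idI I0 nI.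
exists (d * c); first by rewrite mulf_neq0.
by rewrite image_comp; congr (_ @` _); apply/funext => x /=; rewrite mulrA.
Qed.

(** The maximal ideal of W' is a scalar multiple of W as well as of W'. Hence
    W' is a W-module, and it contains 1. *)
Lemma MPD_intermediate_sub (K : fieldType) (V W W' : set K) :
  valuation_ring V -> MPD V -> intermediate V W -> intermediate V W' ->
  W `<=` W'.
Proof.
move=> vV mV iW iW'; have [rW' VW' _ nW'] := iW'; have [rW _ _ _] := iW.
have vW' := overring_valuation vV rW' VW'.
have [w W'w nVw] := intermediate_witness iW'.
have [[N0 ND NM] _] := nonunits_ideal vW'.
have nN : ~ invertible_ideal V (nonunits W').
  by apply: (module_noninvertible vV nVw) => x; exact: NM.
have idN : ideal V (nonunits W') by case: (nonunits_prime vV rW' VW').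
have nN0 := nonunits_neq_set0 vW' nW'.
have [d d0 NE] := MPD_overring_similar vV mV iW idN nN0 nN.
have [c c0 NE'] := MPD_overring_similar vV mV iW' idN nN0 nN.
have: nonunits W' c by rewrite NE'; exists 1; [exact: subring1 | rewrite mulr1].
rewrite {1}NE => -[y Wy dyc] x Wx.
have: nonunits W' (x * c).
  by rewrite NE -dyc; exists (x * y); [exact: subringM | rewrite mulrCA].
by rewrite NE' mulrC => -[z Wz /(mulfI c0) <-].
Qed.

(** A nonzero ideal of V which is a module over a larger ring is noninvertible,
    hence a scalar multiple of W. *)
Lemma MPD_intermediate_nonunits (K : fieldType) (V W : set K) :
  valuation_ring V -> MPD V -> intermediate V W ->
  exists2 e, e != 0 & nonunits W = [set e * x | x in W].
Proof.
move=> vV mV iW; have [rW VW _ nW] := iW.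
have vW := overring_valuation vV rW VW.
have [w Ww nVw] := intermediate_witness iW.
have [[_ _ NM] _] := nonunits_ideal vW.
apply: (MPD_overring_similar vV mV iW).
- by case: (nonunits_prime vV rW VW).
- exact: nonunits_neq_set0.
- by apply: (module_noninvertible vV nVw) => x; exact: NM.
Qed.

(** Otherwise the maximal ideal would be a multiple of W, hence a W-module,
    although it contains the inverse of any element of W outside V. *)
Lemma MPD_intermediate_principal (K : fieldType) (V W : set K) :
  valuation_ring V -> MPD V -> intermediate V W ->
  exists2 p, p != 0 & nonunits V = [set p * x | x in V].
Proof.
move=> vV mV iW; have [rW VW _ nW] := iW; have [rV _] := vV.
have [w Ww nVw] := intermediate_witness iW.
have [|nN] := pselect (invertible_ideal V (nonunits V)).
  by move=> /(invertible_principal vV) [p [_ p0 NE]]; exists p.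
have nV : V <> [set: K] by move=> VK; apply: nVw; rewrite VK.
have nN0 := nonunits_neq_set0 vV nV.
have [d d0 NE] := MPD_overring_similar vV mV iW (nonunits_ideal vV) nN0 nN.
have w0 : w != 0 by apply: contra_notN nVw => /eqP ->; exact: subring0.
have := nonunitsN vV nVw; rewrite NE => -[x Wx dxw].
case: (nonunits1 rV); rewrite NE; exists (w * x); first exact: subringM.
by rewrite mulrCA dxw mulfV.
Qed.

(** * Inverting one element *)

Definition adjoin_inverse (K : fieldType) (V : set K) (t : K) : set K :=
  [set x | exists m, V (t ^+ m * x)].

Lemma sub_adjoin_inverse (K : fieldType) (V : set K) t :
  V `<=` adjoin_inverse V t.
Proof. by move=> x Vx; exists 0%N; rewrite mul1r. Qed.

Lemma adjoin_inverse_inv (K : fieldType) (V : set K) t :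
  is_subring V -> t != 0 -> adjoin_inverse V t t^-1.
Proof. by move=> rV t0; exists 1%N; rewrite expr1 mulfV //; exact: subring1. Qed.

Lemma adjoin_inverse_subring (K : fieldType) (V : set K) t :
  is_subring V -> V t -> is_subring (adjoin_inverse V t).
Proof.
move=> rV Vt; have VX m := subringX m rV Vt; apply/is_subringE; split.
- by apply: sub_adjoin_inverse; exact: subring1.
- move=> x y [m Vx] [l Vy]; exists (m + l)%N.
  rewrite (_ : _ * _ = t ^+ l * (t ^+ m * x) - t ^+ m * (t ^+ l * y)); last first.
    by rewrite exprD; ring.
  by apply: subringB => //; apply: subringM.
- move=> x y [m Vx] [l Vy]; exists (m + l)%N.
  by rewrite exprD mulrACA; exact: subringM.
Qed.

(** The exponent k is minus the order of x at p: after replacing x by its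
    inverse if needed, take the least m with p ^ m / x in V, and k = - m. *)
Lemma unit_mul_exp (K : fieldType) (V : set K) p x :
  valuation_ring V -> p != 0 -> nonunits V = [set p * y | y in V] ->
  x != 0 -> adjoin_inverse V p x -> adjoin_inverse V p x^-1 ->
  exists k : int, units V (p ^ k * x).
Proof.
move=> vV p0 NE; have [rV Vv] := vV.
have main y : y != 0 -> V y -> adjoin_inverse V p y^-1 ->
    exists k : int, units V (p ^ k * y).
  move=> y0 Vy [m0 Vm0]; pose P := [pred m | `[< V (p ^+ m * y^-1) >]].
  have exP : exists m, P m by exists m0; apply/asboolP.
  case: (ex_minnP exP) => -[|m] /asboolP Vm mmin.
    by exists 0; rewrite mul1r; rewrite mul1r in Vm; split=> //; apply/eqP.
  have nVm : ~ V (p ^+ m * y^-1).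
    by move=> /asboolP Pm; have := mmin m Pm; rewrite ltnn.
  have := nonunitsN vV nVm; rewrite NE => -[v Vv' Ev].
  exists (- (m.+1%:Z)); rewrite -exprnN.
  have Ev' : p ^- m.+1 * y = v.
    by apply: (mulfI p0); rewrite Ev exprS; field; rewrite p0 y0 expf_neq0.
  split; first by rewrite Ev'.
    by apply/eqP; rewrite mulf_neq0 // invr_eq0 expf_neq0.
  by rewrite invfM invrK.
move=> x0 px px'; have [Vx|Vx] := Vv x; first exact: main.
have x'0 : x^-1 != 0 by rewrite invr_eq0.
have [|k uk] := main _ x'0 Vx; first by rewrite invrK.
by exists (- k); rewrite -invr_expz -[x]invrK -invfM; exact: unitsV.
Qed.

(** * The value group *)

Definition coset (K : fieldType) (V : set K) (x : K) : set K :=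
  [set x * u | u in units V].

Lemma cosetP (K : fieldType) (V : set K) x y :
  x != 0 -> coset V x y <-> units V (x^-1 * y).
Proof.
move=> x0; split=> [[u Vu <-]|Vu]; first by rewrite mulKf.
by exists (x^-1 * y) => //; rewrite mulVKf.
Qed.

Lemma coset_id (K : fieldType) (V : set K) x : is_subring V -> coset V x x.
Proof. by move=> rV; exists 1; [exact: units1 | rewrite mulr1]. Qed.

Lemma eq_coset (K : fieldType) (V : set K) x y :
  is_subring V -> units V (x^-1 * y) -> x != 0 -> coset V x = coset V y.
Proof.
move=> rV uxy x0; apply/seteqP; split=> [_ [u Vu <-]|_ [u Vu <-]].
  exists (u * (x^-1 * y)^-1); first by apply: unitsM => //; exact: unitsV.
  have [_ /eqP] := uxy; rewrite mulf_eq0 negb_or => /andP[_ y0] _.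
  by field; rewrite x0 y0.
exists ((x^-1 * y) * u); first exact: unitsM.
by rewrite mulrA mulVKf.
Qed.

Lemma value_group_coset (K : fieldType) (V : set K) x :
  valuation_ring V -> x != 0 -> value_group V (coset V x).
Proof.
move=> vV x0; exists x => //; split; first by rewrite valuation_quotient_field.
exact/eqP.
Qed.

Lemma coset_op (K : fieldType) (V : set K) x y :
  is_subring V -> value_group_op (coset V x) (coset V y) = coset V (x * y).
Proof.
move=> rV; apply/seteqP; split=> [_ [_ [u Vu <-] [_ [v Vv <-] <-]]|_ [u Vu <-]].
  by exists (u * v); [exact: unitsM | rewrite mulrACA].
exists x; first exact: coset_id.
by exists (y * u); [exists u | rewrite mulrA].
Qed.

Lemma coset_le (K : fieldType) (V : set K) x y : is_subring V ->
  value_group_le V (coset V x) (coset V y) <-> V (y / x).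
Proof.
move=> rV; split=> [[_ [_ [[u Vu <-] [v Vv <-] Vxy]]]|Vxy].
  have [Vu1 /eqP u0 Vu'] := Vu; have [_ /eqP v0 Vv'] := Vv.
  rewrite (_ : y / x = y * v / (x * u) * (u * v^-1)).
    by apply: subringM => //; exact: subringM.
  have [->|x0] := eqVneq x 0; first by rewrite mul0r invr0 !(mulr0, mul0r).
  by field; rewrite x0 u0 v0.
by exists x, y; split=> //; exact: coset_id.
Qed.

(** The map f is a splitting of the valuation: every coset of units contains
    exactly one value of f. *)
Lemma split_value_group_ZxZ (K : fieldType) (V : set K) (f : int * int -> K) :
  valuation_ring V -> (forall a, f a != 0) ->
  (forall a b, f (a + b) = f a * f b) ->
  (forall x, x != 0 -> exists a, units V (f a * x)) ->
  (forall a, V (f a) <->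
     ((0 : (int *l int)%type) <= (a : (int *l int)%type))%O) ->
  value_group_ZxZ V.
Proof.
move=> vV f0 fD fex fpos; have [rV _] := vV.
have fB a b : f (b - a) = f b / f a.
  by apply: (mulIf (f0 a)); rewrite -fD subrK divfK.
have lexiB (a b : int * int) :
    ((a : (int *l int)%type) <= (b : (int *l int)%type))%O =
    ((0 : (int *l int)%type) <= (b - a : (int *l int)%type))%O.
  case: a b => [a1 a2] [b1 b2]; rewrite !Order.ProdLexiOrder.leEprodlexi /=.
  by rewrite !subr_ge0 !subr_le0.
have fle a b : V (f b / f a) <->
    ((a : (int *l int)%type) <= (b : (int *l int)%type))%O.
  by rewrite lexiB -fB; exact: fpos.
have finj a b : coset V (f a) = coset V (f b) -> a = b.
  move=> eqab; have: coset V (f b) (f a) by rewrite -eqab; exact: coset_id.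
  move=> /(cosetP _ _ (f0 b)) [+ _].
  rewrite invfM invrK !(mulrC _ (f a)) mulrC => Vab Vba.
  apply: (@le_anti _ (int *l int)%type); apply/andP; split; apply/fle => //.
  by rewrite mulrC.
pose phi A := xget 0 [set a | A = coset V (f a)].
have phif a : phi (coset V (f a)) = a.
  by apply: xget_unique => // b /finj ->.
have valP A : value_group V A -> exists a, A = coset V (f a).
  move=> [x [_ /eqP x0] <-]; have x'0 : x^-1 != 0 by rewrite invr_eq0.
  have [a ua] := fex _ x'0; exists a; apply: eq_coset => //.
  by rewrite mulrC.
exists phi; split.
- split=> // [A B /set_mem/valP [a ->] /set_mem/valP [b ->]|a _].
    by rewrite !phif => ->.
  by exists (coset V (f a)); [exact: value_group_coset | exact: phif].
- move=> A B /valP [a ->] /valP [b ->].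
  by rewrite coset_op // -fD !phif.
- move=> A B /valP [a ->] /valP [b ->]; rewrite !phif.
  by rewrite coset_le //; exact: fle.
Qed.

Lemma expz_nonunit (K : fieldType) (V : set K) p (k : int) :
  is_subring V -> p != 0 -> nonunits V p -> V (p ^ k) -> 0 <= k.
Proof.
move=> rV p0 [Vp np]; case: k => // k; rewrite NegzE -exprnN => Vpk.
case: np; split=> //; first exact/eqP.
rewrite (_ : p^-1 = p ^+ k * p ^- k.+1).
  by apply: subringM => //; exact: subringX.
by rewrite exprS invfM mulrCA mulfV ?mulr1 // expf_neq0.
Qed.

(** The maximal ideals of V and W are principal, generated by p and e. As V[1/p]
    contains W and W[1/e] = K, every nonzero x is a unit of V times some
    e ^ k * p ^ l. The order is lexicographic because p is a unit of W, while
    all multiples of e by elements of W lie in V. *)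
Lemma intermediate_ZxZ (K : fieldType) (V W : set K) :
  valuation_ring V -> MPD V -> intermediate V W -> value_group_ZxZ V.
Proof.
move=> vV mV iW; have [rW VW WV nW] := iW; have [rV Vv] := vV.
have vW := overring_valuation vV rW VW; have [_ Wv] := vW.
have [e e0 We] := MPD_intermediate_nonunits vV mV iW.
have [p p0 Vp] := MPD_intermediate_principal vV mV iW.
have Ne : nonunits W e by rewrite We; exists 1; [exact: subring1 | rewrite mulr1].
have Np : nonunits V p by rewrite Vp; exists 1; [exact: subring1 | rewrite mulr1].
have [We1 Vp1] : W e /\ V p by split; [case: Ne|case: Np].
have not_adj (R : set K) (t : K) :
    valuation_ring R -> t != 0 -> nonunits R t -> adjoin_inverse R t <> R.
  move=> [rR _] t0 [Rt nt] aR; apply: nt; split=> //; first exact/eqP.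
  by rewrite -aR; exact: adjoin_inverse_inv.
(* As only W lies strictly between V and K, inverting e in W yields K, and
   inverting p in V yields W or K. *)
have adjW x : adjoin_inverse W e x.
  have rA := adjoin_inverse_subring rW We1.
  have sA := @sub_adjoin_inverse _ W e.
  have [->//|nA] := pselect (adjoin_inverse W e = [set: K]).
  case: (not_adj _ _ vW e0 Ne); apply/seteqP; split=> //.
  apply: (MPD_intermediate_sub vV mV) => //; split=> // [y Vy|AV].
    exact/sA/VW.
  by apply: WV; apply/seteqP; split=> // y /sA; rewrite AV.
have adjV : W `<=` adjoin_inverse V p.
  have rA := adjoin_inverse_subring rV Vp1.
  have sA := @sub_adjoin_inverse _ V p.
  have [->//|nA] := pselect (adjoin_inverse V p = [set: K]).
  by apply: (MPD_intermediate_sub vV mV) => //; split=> //; exact: not_adj.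
(* The inverse of an element of W outside V is a multiple of p. *)
have up : units W p.
  have [w Ww nVw] := intermediate_witness iW.
  have := nonunitsN vV nVw; rewrite Vp => -[v Vv1 pv].
  apply: (@units_factor _ _ _ v) => //; [exact: VW | exact: VW |].
  have w0 : w != 0 by apply: contra_notN nVw => /eqP ->; exact: subring0.
  rewrite pv; split; [|by apply/eqP; rewrite invr_eq0|by rewrite invrK].
  by rewrite -pv; apply: VW; exact: subringM.
have upz l : units W (p ^ l).
  case: l => l; first exact: unitsX.
  by rewrite NegzE -exprnN; apply: unitsV; exact: unitsX.
apply: (@split_value_group_ZxZ _ _ (fun a => e ^ a.1 * p ^ a.2)) => //.
- by move=> a; rewrite mulf_neq0 // expfz_neq0.
- by move=> a b; rewrite !expfzDr // mulrACA.
- move=> x x0.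
  have [k [Wk /eqP kx0 Wk']] := unit_mul_exp vW e0 We x0 (adjW _) (adjW _).
  have [l ul] := unit_mul_exp vV p0 Vp kx0 (adjV _ Wk) (adjV _ Wk').
  by exists (k, l); rewrite /= mulrAC mulrC.
- move=> [k l]; rewrite Order.ProdLexiOrder.leEprodlexi /=.
  have Wkl : W (e ^ k * p ^ l) -> 0 <= k.
    move=> Wkl; apply: (expz_nonunit rW e0 Ne).
    rewrite -(mulfK (expfz_neq0 l p0) (e ^ k)).
    by apply: subringM => //; case: (upz l).
  split=> [Vkl|].
    have k0 := Wkl (VW _ Vkl); rewrite k0 /=; apply/implyP => k0'.
    have kE : k = 0 by apply: le_anti; rewrite k0 k0'.
    by apply: (expz_nonunit rV p0 Np); rewrite kE mul1r in Vkl.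
  case/andP=> {Wkl}; rewrite le_eqVlt => /orP[/eqP <- /= l0|].
    by rewrite mul1r; case: l l0 => // l _; exact: subringX.
  case: k => [[|k]|] // _ _.
  apply: (proj1 (sub_nonunits vV VW _)); rewrite We; exists (e ^+ k * p ^ l).
    by apply: subringM => //; [exact: subringX | case: (upz l)].
  by rewrite mulrA -exprS.
Qed.

(** For t of value (0, 1), inverting t captures the elements of value (0, l)
    but no inverse of an element of value (1, 0). *)
Lemma ZxZ_intermediate (K : fieldType) (V : set K) :
  valuation_ring V -> value_group_ZxZ V -> exists W, intermediate V W.
Proof.
move=> vV [phi [[_ _ psurj] phiD phile]]; have [rV _] := vV.
pose v x := phi (coset V x).
have valP x : x != 0 -> value_group V (coset V x) by exact: value_group_coset.
have vM x y : x != 0 -> y != 0 -> v (x * y) = v x + v y.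
  by move=> x0 y0; rewrite /v -coset_op // phiD //; exact: valP.
have vle x y : x != 0 -> y != 0 -> V (y / x) ->
    ((v x : (int *l int)%type) <= (v y : (int *l int)%type))%O.
  move=> x0 y0 Vyx; apply/phile; [exact: valP|exact: valP|].
  exact/coset_le.
have v1 : v 1 = 0.
  apply: (addrI (v 1)); rewrite addr0 -vM ?mulr1 //; exact: oner_neq0.
have vX x m : x != 0 -> v (x ^+ m) = v x *+ m.
  move=> x0; elim: m => [|m IHm]; first by rewrite v1.
  by rewrite exprS vM ?expf_neq0 // IHm mulrS.
have vsurj a : exists2 x, x != 0 & v x = a.
  by have [_ [x [_ /eqP x0] <-] <-] := psurj a I; exists x.
have K1 := oner_neq0 K.
have [t t0 vt] := vsurj (0, 1); have [s s0 vs] := vsurj (1, 0).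
have Vt : V t.
  rewrite -(divr1 t); apply/coset_le => //.
  apply/phile; [exact: valP|exact: valP|].
  by rewrite -/(v 1) -/(v t) v1 vt.
exists (adjoin_inverse V t); split.
- exact: adjoin_inverse_subring.
- exact: sub_adjoin_inverse.
- move=> eqV; have := adjoin_inverse_inv rV t0; rewrite eqV => Vt'.
  by have := vle t 1 t0 K1; rewrite mul1r v1 vt => /(_ Vt').
- move=> eqK; have: adjoin_inverse V t s^-1 by rewrite eqK.
  move=> [m Vm]; have := vle s (t ^+ m) s0 (expf_neq0 m t0) Vm.
  rewrite vs vX // vt Order.ProdLexiOrder.leEprodlexi /=.
  by rewrite (_ : ((0, 1) *+ m).1 = 0) // (raddfMn fst) mul0rn.
Qed.


(** A ring W is supplied even when no ring is intermediate, so that one can be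
    chosen for all members of a family at once. *)
Lemma MPD_overrings (K : fieldType) (V : set K) :
  valuation_ring V -> MPD V ->
  exists W, (value_group_ZxZ V -> intermediate V W) /\
    forall R, intermediate V R -> value_group_ZxZ V /\ R = W.
Proof.
move=> vV mV; have [[W iW]|nW] := pselect (exists W, intermediate V W).
  exists W; split=> // R iR; split; first exact: intermediate_ZxZ iR.
  by apply/seteqP; split; apply: (MPD_intermediate_sub vV mV).
(* Without an intermediate ring both clauses are vacuous for any choice. *)
exists setT; split=> [zV|R iR]; last by case: nW; exists R.
by case: nW; exact: ZxZ_intermediate.
Qed.

(** * Separating finitely many valuation rings *)

Lemma geometric_sumD (R : pzRingType) (x : R) m c :
  \sum_(j < c + m) x ^+ j = \sum_(j < c) x ^+ j + x ^+ c * \sum_(j < m) x ^+ j.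
Proof.
rewrite big_split_ord /=; congr (_ + _); rewrite mulr_sumr.
by apply: eq_bigr => j _; rewrite exprD.
Qed.

Lemma geometric_sumV (K : fieldType) (x : K) s : x != 0 ->
  \sum_(j < s.+1) x ^+ j = x ^+ s * \sum_(j < s.+1) x^-1 ^+ j.
Proof.
move=> x0; rewrite mulr_sumr (reindex_inj rev_ord_inj) /=; apply: eq_bigr => j _.
by rewrite subSS exprVn expfB_cond // (negPf x0) /= leq_ord.
Qed.

(** If no geometric sum of x is a nonunit then c = 1 works; otherwise c is the
    length of one that is, and s = 1 mod c makes the sum of length s
    congruent to 1 modulo the maximal ideal. *)
Lemma geometric_sum_unit (K : fieldType) (V : set K) x :
  valuation_ring V -> V x -> exists2 c, (0 < c)%N &
    forall k, units V (\sum_(j < (k * c).+1) x ^+ j).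
Proof.
move=> vV Vx; have [rV _] := vV; have [[_ ND NM] _] := nonunits_ideal vV.
have idV := subringT_ideal rV.
have VX j : V (x ^+ j) by exact: subringX.
have VS s : V (\sum_(j < s) x ^+ j) by exact: (ideal_sum idV).
have [[c Nc]|nu] :=
    pselect (exists c, nonunits V (\sum_(j < c.+1) x ^+ j)); last first.
  exists 1%N => // k; apply: contrapT => nk; apply: nu.
  by exists (k * 1)%N; split.
exists c.+1 => // k.
have Nk : nonunits V (\sum_(j < k * c.+1) x ^+ j).
  elim: k => [|k IHk]; first by rewrite big_ord0; split; [exact: subring0|case].
  by rewrite mulSn geometric_sumD; apply: ND => //; exact: NM.
apply: contrapT => nu; apply: (nonunits1 rV).
have Nk1 : nonunits V (\sum_(j < (k * c.+1).+1) x ^+ j) by split.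
rewrite (_ : 1 = \sum_(j < (k * c.+1).+1) x ^+ j +
                 (- x) * \sum_(j < k * c.+1) x ^+ j).
  by apply: ND => //; apply: NM => //; exact: subringN.
by rewrite -add1n geometric_sumD big_ord1 expr0 expr1 mulNr addrK.
Qed.

(** Take y = 1 / (1 + x + ... + x ^ s). When x is not in V i the last term of
    the sum dominates, so that y has the value of x ^ - s. *)
Lemma common_denominator (K : fieldType) n (V : 'I_n -> set K) x :
  (0 < n)%N -> (forall i, valuation_ring (V i)) ->
  exists2 y, y != 0 &
    forall i, [/\ V i y, V i (y * x) & V i x -> units (V i) y].
Proof.
move=> n0 vV.
have ex_c i : exists c, (0 < c)%N /\ (V i x ->
    forall k, units (V i) (\sum_(j < (k * c).+1) x ^+ j)).
  have [Vx|nVx] := pselect (V i x); last by exists 1%N.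
  by have [c c0 uc] := geometric_sum_unit (vV i) Vx; exists c.
have [c cP] := choice ex_c.
(* The exponent s is a multiple of each c i, so one sum serves all i. *)
pose s := (\prod_i c i)%N; pose S := \sum_(j < s.+1) x ^+ j.
have s0 : (0 < s)%N by apply: prodn_gt0 => i; case: (cP i).
have uS i : V i x -> units (V i) S.
  move=> /(cP i).2 uc; rewrite /S /s (bigD1 i) //= mulnC; exact: uc.
have uS' i : ~ V i x -> x != 0 /\ units (V i) (x^-1 ^+ s * S).
  move=> nVx; have [rV _] := vV i; have [Vx' nx'] := nonunitsN (vV i) nVx.
  have x0 : x != 0 by apply: contra_notN nVx => /eqP ->; exact: subring0.
  split=> //; rewrite /S geometric_sumV // mulrA -exprMn mulVf // expr1n mul1r.
  have VS m : V i (\sum_(j < m) x^-1 ^+ j).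
    by apply: (ideal_sum (subringT_ideal rV)) => j; exact: subringX.
  apply: contrapT => nS; apply: (nonunits1 rV).
  have [[_ ND NM] _] := nonunits_ideal (vV i).
  rewrite (_ : 1 = \sum_(j < s.+1) x^-1 ^+ j +
                   (- \sum_(j < s) x^-1 ^+ j) * x^-1).
    by apply: ND; [split | apply: NM => //; exact: subringN].
  by rewrite -[s.+1]add1n geometric_sumD big_ord1 expr0 expr1 mulNr mulrC addrK.
have S0 : S != 0.
  pose i0 := Ordinal n0.
  have [/uS [_ /eqP]//|/uS' [_ [_ /eqP]]] := pselect (V i0 x).
  by rewrite mulf_eq0 negb_or => /andP[].
exists S^-1; first by rewrite invr_eq0.
move=> i; have [rV _] := vV i; have [Vx|nVx] := pselect (V i x).
  have uSi := unitsV (uS i Vx); have VSi : V i S^-1 by case: uSi.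
  by split=> //; exact: subringM.
have [x0 /unitsV [Vu _ _]] := uS' i nVx; have [Vx' _] := nonunitsN (vV i) nVx.
have VX m : V i (x^-1 ^+ m) by exact: subringX.
split=> //.
  rewrite (_ : S^-1 = (x^-1 ^+ s * S)^-1 * x^-1 ^+ s); first exact: subringM.
  by rewrite invfM mulrAC mulVf ?mul1r // expf_neq0 // invr_eq0.
rewrite (_ : S^-1 * x = (x^-1 ^+ s * S)^-1 * x^-1 ^+ s.-1); first exact: subringM.
rewrite -[X in (_ ^+ X * S)^-1](prednK s0) exprS.
have : x^-1 ^+ s.-1 != 0 by rewrite expf_neq0 // invr_eq0.
by move: (x^-1 ^+ s.-1) => z z0; field; rewrite S0 x0 z0.
Qed.

(** Prime avoidance: when a lies in P j but in no earlier P i, add to it an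
    element of A lying in all the earlier P i but not in P j. *)
Lemma prime_avoidance (K : fieldType) (D A : set K) n (P : 'I_n -> set K) :
  is_subring D -> ideal D A -> (forall i, prime_ideal D (P i)) ->
  (forall i j, i <> j -> ~ P i `<=` P j) -> (forall i, ~ A `<=` P i) ->
  exists2 x, A x & forall i, ~ P i x.
Proof.
move=> rD [[A0 AD AM] AsD] primeP incP AP.
have out (B C : set K) : ~ B `<=` C -> exists2 x, B x & ~ C x.
  apply: contra_notP => nx x Bx; apply: contrapT => nCx.
  by apply: nx; exists x.
have isolate j (s : seq 'I_n) : j \notin s ->
    exists b, [/\ A b, ~ P j b & forall i, i \in s -> P i b].
  elim: s => [_|i s IHs]; first by have [b] := out _ _ (AP j); exists b.
  rewrite inE negb_or => /andP[/eqP ji /IHs [b [Ab nb Pb]]].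
  have [e Pe ne] := out _ _ (incP i j (fun ij => ji (esym ij))).
  have [[[_ _ PM] PsD] _ _] := primeP i; have De := PsD _ Pe.
  exists (e * b); split; first exact: AM.
    have [_ _ prP] := primeP j; by case/(prP _ _ De (AsD _ Ab)).
  move=> k; rewrite inE => /orP[/eqP ->|ks].
    by rewrite mulrC; apply: PM => //; exact: AsD.
  by have [[[_ _ PkM] _] _ _] := primeP k; apply: PkM => //; exact: Pb.
have PB i x y : P i (x + y) -> P i x -> P i y.
  have [[[_ PD PM] _] _ _] := primeP i => Pxy Px.
  rewrite (_ : y = x + y + -1 * x); last by ring.
  by apply: PD => //; apply: PM => //; apply: subringN => //; exact: subring1.
suff [x Ax nx] : exists2 x, A x & forall i, i \in enum 'I_n -> ~ P i x.
  by exists x => // i; apply: nx; rewrite mem_enum.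
elim: (enum 'I_n) (enum_uniq 'I_n) => [_|j s IHs]; first by exists 0.
rewrite cons_uniq => /andP[js /IHs [a Aa na]].
have [Pa|nPa] := pselect (P j a); last first.
  by exists a => // i; rewrite inE => /orP[/eqP ->//|]; exact: na.
have [b [Ab nb Pb]] := isolate j s js.
exists (a + b); first exact: AD.
move=> i; rewrite inE => /orP[/eqP ->|is_] Pab.
  by apply: nb; exact: PB Pab Pa.
by apply: (na i) => //; rewrite addrC in Pab; exact: PB Pab (Pb _ is_).
Qed.

(** * The intersection of finitely many incomparable valuation rings *)

Definition intersection (K : fieldType) n (V : 'I_n -> set K) : set K :=
  \bigcap_(i in [set: 'I_n]) V i.

Definition incomparable_valuations (K : fieldType) n (V : 'I_n -> set K) :=
  [/\ (0 < n)%N, forall i, valuation_ring (V i)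
    & forall i j, i <> j -> ~ V i `<=` V j].

(** The contraction to D of the maximal ideal of V. *)
Definition center (K : fieldType) (D V : set K) : set K := D `\` units V.

Lemma intersection_subring (K : fieldType) n (V : 'I_n -> set K) :
  incomparable_valuations V -> is_subring (intersection V).
Proof.
move=> [_ vV _]; apply/is_subringE; split.
- by move=> i _; apply: subring1; case: (vV i).
- by move=> x y Dx Dy i _; apply: subringB; [case: (vV i)|exact: Dx|exact: Dy].
- by move=> x y Dx Dy i _; apply: subringM; [case: (vV i)|exact: Dx|exact: Dy].
Qed.

Lemma sub_intersection (K : fieldType) n (V : 'I_n -> set K) i :
  intersection V `<=` V i.
Proof. by move=> x; exact. Qed.

Lemma center_prime (K : fieldType) (D V : set K) :
  is_subring D -> valuation_ring V -> D `<=` V -> prime_ideal D (center D V).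
Proof.
move=> rD vV DV; have [rV _] := vV; have [[_ ND NM] _] := nonunits_ideal vV.
have CE x : center D V x <-> D x /\ nonunits V x.
  by split=> [[Dx nx]|[Dx [_ nx]]]; split=> //; split=> //; exact: DV.
split.
- split; last by move=> x [].
  split; first by split; [exact: subring0|case].
    move=> x y /CE[Dx Nx] /CE[Dy Ny]; apply/CE.
    by split; [exact: subringD|exact: ND].
  move=> a x Da /CE[Dx Nx]; apply/CE.
  by split; [exact: subringM|apply: NM => //; exact: DV].
- move=> CD; have [_] : center D V 1 by rewrite CD; exact: subring1.
  by apply; exact: units1.
- move=> a b Da Db [_ nab]; apply: contrapT => /not_orP[na nb]; apply: nab.
  apply: unitsM => //; first by apply: contrapT => nu; apply: na.
  by apply: contrapT => nu; apply: nb.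
Qed.

(** A fraction y * x / y of elements of D, with y a unit of V i, represents any
    x in V i. *)
Lemma localization_center (K : fieldType) n (V : 'I_n -> set K) i :
  incomparable_valuations V ->
  localization (intersection V) (center (intersection V) (V i)) = V i.
Proof.
move=> [n0 vV _]; have [rV _] := vV i.
apply/seteqP; split=> [_ [a [s [Da Ds ns ->]]]|x Vx].
  have [_ _ Vs] : units (V i) s by apply: contrapT => nu; apply: ns.
  by apply: subringM => //; exact: sub_intersection Da.
have [y y0 yP] := common_denominator x n0 vV.
exists (y * x), y; split; last by rewrite mulrC mulKf.
- by move=> j _; case: (yP j).
- by move=> j _; case: (yP j).
- by case=> _; apply; case: (yP i) => _ _; exact.
Qed.

Lemma intersection_quotient_field (K : fieldType) n (V : 'I_n -> set K) :
  incomparable_valuations V -> quotient_field (intersection V) = [set: K].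
Proof.
move=> [n0 vV _]; apply/seteqP; split=> // x _.
have [y y0 yP] := common_denominator x n0 vV.
exists (y * x), y; split; last by rewrite mulrC mulKf.
- by move=> j _; case: (yP j).
- by move=> j _; case: (yP j).
- exact/eqP.
Qed.

(** An inclusion of centers gives the opposite inclusion of localizations. *)
Lemma center_incomparable (K : fieldType) n (V : 'I_n -> set K) i j :
  incomparable_valuations V -> i <> j ->
  ~ center (intersection V) (V i) `<=` center (intersection V) (V j).
Proof.
move=> incV ij Cij; have [_ _ nV] := incV; apply: (nV j i) => [/esym //|].
rewrite -(localization_center j incV) -(localization_center i incV).
move=> _ [a [s [Da Ds ns ->]]]; exists a, s; split=> // Cs; exact/ns/Cij.
Qed.

(** By prime avoidance an ideal contained in no center contains an element
    which is a unit in each V i, hence in D. *)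
Lemma proper_ideal_center (K : fieldType) n (V : 'I_n -> set K) (I : set K) :
  incomparable_valuations V -> ideal (intersection V) I ->
  I <> intersection V -> exists i, I `<=` center (intersection V) (V i).
Proof.
move=> incV idI nI; have [_ vV _] := incV; have rD := intersection_subring incV.
apply: contrapT => /forallNP nIC.
have [x Ix nx] := prime_avoidance rD idI
  (fun i => center_prime rD (vV i) (@sub_intersection _ _ V i))
  (fun i j => @center_incomparable _ _ V i j incV) nIC.
have Dx : intersection V x by case: idI => _; exact.
have ux i : units (V i) x by apply: contrapT => nu; apply: (nx i).
have [_] := proper_ideal_nonunits idI nI Ix; apply; split=> //.
  have [n0 _ _] := incV; by case: (ux (Ordinal n0)).
by move=> i _; case: (ux i).
Qed.

Lemma center_maximal (K : fieldType) n (V : 'I_n -> set K) i :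
  incomparable_valuations V ->
  maximal_ideal (intersection V) (center (intersection V) (V i)).
Proof.
move=> incV; have [_ vV _] := incV; have rD := intersection_subring incV.
have [idC nC _] := center_prime rD (vV i) (@sub_intersection _ _ V i).
split=> // I idI nI CI; have [j Ij] := proper_ideal_center incV idI nI.
have [ij|ij] := pselect (i = j); last first.
  by case: (center_incomparable incV ij) => x /CI; exact: Ij.
by apply/seteqP; split=> //; rewrite ij.
Qed.

(** The maximal ideal N of a quasi-local overring R contracts to a proper ideal
    of D, contained in the center of some V i; the elements of D outside that
    center are units of R, so that R contains the localization V i. *)
Lemma quasi_local_overring (K : fieldType) n (V : 'I_n -> set K) (R : set K) :
  incomparable_valuations V ->
  O_ql (intersection V) R <-> is_subring R /\ exists i, V i `<=` R.
Proof.
move=> incV; have [_ vV _] := incV; have rD := intersection_subring incV.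
split=> [[[rR DR _] [N [[idN nN _] Nuniq]]]|[rR [i VR]]]; last first.
  split; last exact/valuation_quasi_local/(overring_valuation (vV i)).
  split=> //; last by rewrite intersection_quotient_field.
  by move=> x /(@sub_intersection _ _ V i) /VR.
split=> //; have [[N0 ND NM] NR] := idN.
pose P := intersection V `&` N.
have idP : ideal (intersection V) P.
  split; last by move=> x [].
  split; first by split=> //; exact: (subring0 rD).
    by move=> x y [Dx Nx] [Dy Ny]; split; [exact: (subringD rD)|exact: ND].
  move=> a x Da [Dx Nx]; split; first exact: (subringM rD).
  by apply: NM => //; exact: DR.
have nP : P <> intersection V.
  move=> PD; have [_] : P 1 by rewrite PD; exact: (subring1 rD).
  exact: (proper_ideal1 idN nN).
have [i PC] := proper_ideal_center incV idP nP; exists i.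
rewrite -(localization_center i incV) => _ [a [s [Da Ds ns ->]]].
have nNs : ~ N s by move=> Ns; apply: ns; exact: PC.
suff [_ _ Rs] : units R s by apply: subringM => //; exact: DR.
apply: contrapT => nu; apply: nNs.
have Rs := DR _ Ds; have idS := principal_ideal rR Rs.
have nS : [set s * x | x in R] <> R.
  move=> SR; have : [set s * x | x in R] 1 by rewrite SR; exact: subring1.
  move=> [x Rx sx1]; apply: nu; apply: (units_factor rR Rs Rx).
  by rewrite sx1; exact: units1.
have [M [maxM SM]] := ex_maximal_ideal rR idS nS.
by rewrite (Nuniq _ maxM); apply: SM; exists 1; [exact: subring1|rewrite mulr1].
Qed.

(** * Counting *)

Lemma card_setT_finType (T : finType) : ([set: T] #= `I_#|T|)%card.
Proof.
have -> : [set: T] = (@enum_val T T) @` [set: 'I_#|T|].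
  by apply/seteqP; split=> // x _; exists (enum_rank x); rewrite ?enum_rankK.
apply: card_eq_trans (card_esym card_II).
by apply: inj_card_eq => i j _ _; exact: enum_val_inj.
Qed.

(** The list K, the V i, and the W i for i in S, is exhaustive; it has no
    repetition, since a ring over V i and V j with i <> j is K by
    independence. *)
Lemma card_overrings (K : fieldType) n (V W : 'I_n -> set K) (S : {pred 'I_n}) :
  (0 < n)%N -> (forall i, valuation_ring (V i)) -> (forall i, V i <> [set: K]) ->
  (forall i j, i <> j -> independent (V i) (V j)) ->
  (forall i, S i -> intermediate (V i) (W i)) ->
  (forall i R, intermediate (V i) R -> S i /\ R = W i) ->
  ([set R | is_subring R /\ exists i, V i `<=` R] #= `I_(n + #|S|).+1)%card.
Proof.
move=> n0 vV nK indep WS WP.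
pose T : finType := option ('I_n + {i | S i}).
pose f (t : T) := match t with
  | None => [set: K] | Some (inl i) => V i | Some (inr i) => W (val i) end.
have rV i : is_subring (V i) by case: (vV i).
have top i j R : i <> j -> is_subring R -> V i `<=` R -> V j `<=` R -> R = setT.
  by move=> ij; exact: (independent_overring (vV i) (vV j) (indep _ _ ij)).
have eqi i j R : is_subring R -> R <> setT -> V i `<=` R -> V j `<=` R -> i = j.
  move=> rR nR Vi Vj; apply: contrapT => ij; exact/nR/(top i j).
have finj : injective f.
  move=> [[i|[i Si]]|] [[j|[j Sj]]|] //= eqf.
  - by rewrite (eqi i j (V i)) //= eqf.
  - have [rW VW WV nW] := WS _ Sj.
    have ij : i = j by apply: (eqi i j (W j)) => //; rewrite -eqf.
    by case: WV; rewrite -eqf ij.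
  - by case: (nK i).
  - have [rW VW WV nW] := WS _ Si.
    have ij : j = i by apply: (eqi j i (W i)) => //; rewrite eqf.
    by case: WV; rewrite eqf ij.
  - have [rW VW WV nW] := WS _ Si; have [_ VW' _ _] := WS _ Sj.
    have ij : i = j by apply: (eqi i j (W i)) => //; rewrite eqf.
    by congr (Some (inr _)); apply: val_inj.
  - by have [_ _ _] := WS _ Si; rewrite eqf.
  - by case: (nK j).
  - by have [_ _ _] := WS _ Sj; rewrite -eqf.
have -> : [set R | is_subring R /\ exists i, V i `<=` R] = f @` [set: T].
  apply/seteqP; split=> [R [rR [i VR]]|_ [t _ <-]].
    have [->|nV] := pselect (R = V i); first by exists (Some (inl i)).
    have [->|nR] := pselect (R = setT); first by exists None.
    have [Si ->] := WP i R (And4 rR VR nV nR).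
    by exists (Some (inr (exist _ i Si))).
  case: t => [[i|[i Si]]|] /=; first by split=> //; exists i.
    by have [rW VW _ _] := WS i Si; split=> //; exists i.
  by split; [exact: subring_setT | exists (Ordinal n0)].
apply: card_eq_trans (inj_card_eq (in2W finj)) _.
have <- : #|T| = (n + #|S|).+1 by rewrite card_option card_sum card_ord card_sig.
exact: card_setT_finType.
Qed.

Theorem corollary8 (K : fieldType) (n : nat) (V : 'I_n -> set K)
    (D : set K) (D_def : D = \bigcap_(i in [set: 'I_n]) V i)
    (n_ge1 : (1 <= n)%N)
    (V_val : forall i : 'I_n, valuation_domain (V i))
    (V_frac : forall i : 'I_n, quotient_field (V i) = [set: K])
    (V_nonfield : forall i : 'I_n, ~ is_field (V i))
    (V_indep : forall i j : 'I_n, i <> j -> independent (V i) (V j))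
    (D_GMPD : GMPD D) :
  ((O_ql D #= `I_n.+1)%card <-> forall i : 'I_n, ~ value_group_ZxZ (V i)) /\
  ((O_ql D #= `I_(2 * n).+1)%card <-> forall i : 'I_n, value_group_ZxZ (V i)).
Proof.
have vV i : valuation_ring (V i) by exact: valuation_ring_domain.
have incV : incomparable_valuations V by split=> // i j /V_indep [].
have nK i : V i <> [set: K] by move=> VK; apply: (V_nonfield i); rewrite VK.
have mV i : MPD (V i).
  have [_ locD] := D_GMPD; rewrite -(localization_center i incV).
  by rewrite D_def in locD; apply: locD; exact: center_maximal.
have [W WP] := choice (fun i => MPD_overrings (vV i) (mV i)).
pose S : {pred 'I_n} := [pred i | `[< value_group_ZxZ (V i) >]].
have O_qlE : O_ql D = [set R | is_subring R /\ exists i, V i `<=` R].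
  by apply/seteqP; rewrite D_def; split=> R /(quasi_local_overring _ incV).
have cardO : (O_ql D #= `I_(n + #|S|).+1)%card.
  rewrite O_qlE; apply: (card_overrings n_ge1 vV nK V_indep (W := W)) => i.
    by move=> /asboolP; exact: (WP i).1.
  by move=> R /(WP i).2 [zV ->]; split=> //; apply/asboolP.
have cardOP m : (O_ql D #= `I_m)%card <-> (n + #|S|).+1 = m.
  rewrite (card_eql cardO); split=> [/card_eq_II//|->]; exact: card_eqxx.
split; rewrite cardOP.
- split=> [[nS] i zV|nZ].
    have /card0_eq S0 : #|S| = 0%N by apply: (@addnI n); rewrite addn0.
    by have := S0 i; rewrite inE => /asboolP.
  by rewrite eq_card0 ?addn0 // => i; apply/asboolP; exact: nZ.
- split=> [[nS] i|Z].
    have Sn : #|S| = n by apply: (@addnI n); rewrite nS mul2n addnn.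
    have /card0_eq/(_ i) : #|[predC S]| = 0%N.
      by apply: (@addnI #|S|); rewrite addn0 cardC card_ord.
    by rewrite !inE => /negbFE/asboolP.
  rewrite (_ : #|S| = n) ?addnn ?mul2n //; rewrite -[RHS]card_ord.
  by apply: eq_card => i; apply/asboolP; exact: Z.
Qed.
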